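(* The class of $\cup$-bases of core compact sober spaces is dual to the class of $\prec$-distributive $\vee$-predomains, in the following sense. (1) If $S\subseteq\mathcal{O}(X)$ is a $\cup$-basis of a core compact sober space $X$, then $(S,\subseteq,\Subset)$ is a $\Subset$-distributive $\cup$-predomain (i.e. a $\prec$-distributive $\vee$-predomain with $\leq$, $\vee$, $\prec$ being $\subseteq$, $\cup$, $\Subset$), and $x\mapsto S_x=\{s\in S:x\in s\}$ is a homeomorphism from $X$ onto the spectrum $\widehat{S}$ of $(S,\subseteq,\Subset)$. (2) If $(S,\leq,\prec)$ is a $\prec$-distributive $\vee$-predomain, then its spectrum $\widehat{S}$ is a core compact sober space, $\{\widehat{S}_p:p\in S\}$ is a $\cup$-basis of $\widehat{S}$, and $p\mapsto\widehat{S}_p$ is an isomorphism from $(S,\leq,\prec)$ onto $(\{\widehat{S}_p:p\in S\},\subseteq,\Subset)$, i.e. it is a bijection such that, for all $p,q\in S$, $p\leq q\Leftrightarrow\widehat{S}_p\subseteq\widehat{S}_q$ and $p\prec q\Leftrightarrow\widehat{S}_p\Subset\widehat{S}_q$.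
   Context: Topology. $\mathcal{O}(X)$ is the lattice of open subsets of $X$. For $p,q\in\mathcal{O}(X)$, $p\Subset q$ means every open cover of $q$ has a finite subfamily covering $p$ (on a basis $S$, $\Subset$ is the restriction of this relation). $X$ is core compact if for every $x\in X$ and every open $O\ni x$ there is an open $N\ni x$ with $N\Subset O$. A non-empty closed set is irreducible if it is not the union of two proper closed subsets (i.e. its proper closed subsets form an ideal); $X$ is sober if every irreducible closed set is the closure of a unique point. A $\cup$-basis of $X$ is a basis of the topology closed under finite unions, including the empty union (so it contains $\emptyset$). Order. $(S,\leq)$ is a $\vee$-semilattice (poset with binary joins $\vee$) with minimum $0$, equipped with a binary relation $\prec$. A filter is a non-empty $F\subseteq S$ such that for all $p,q\in S$: $p,q\in F$ iff there is $r\in F$ with $r\leq p,q$. An ideal is a non-empty $I\subseteq S$ such that for all $p,q\in S$: $p,q\in I$ iff there is $r\in I$ with $r\geq p,q$. A filter $P$ is prime if $S\setminus P$ is an ideal; proper if $P\neq S$; round if for every $p\in P$ there is $r\in P$ with $r\prec p$. The spectrum of $(S,\leq,\prec)$ is the set $\widehat{S}$ of all proper round prime filters, with the topology generated by the sets $\widehat{S}_p=\{P\in\widehat{S}:p\in P\}$, $p\in S$. $\prec$ is distributive if for all $p,s,t\in S$: $p\prec s\vee t$ implies that for every $p'\prec p$ there are $s'\prec s$ and $t'\prec t$ with $p'\leq s'\vee t'\leq p$. $\prec$ is auxiliary if for all $p,p',q,q'\in S$: $p\leq p'\prec q'\leq q$ implies $p\prec q$, and $p\prec q$ implies $p\leq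 q$. $\prec$ is interpolative if whenever $p\prec q$ there is $s\in S$ with $p\prec s\prec q$. $\prec$ is approximating if for all $p,q\in S$: $p\leq q$ iff $\{r\in S:r\prec p\}\subseteq\{r\in S:r\prec q\}$. $\prec$ is $\vee$-preserving if for all $p,p',q,q'\in S$: $p'\prec p$ and $q'\prec q$ imply $p'\vee q'\prec p\vee q$. $S$ is a $\vee$-predomain if $\prec$ is auxiliary, approximating, interpolative and $\vee$-preserving; it is a $\prec$-distributive $\vee$-predomain if moreover $\prec$ is distributive.
   Formalization: The equivalence p ≺ q ⇔ Ŝ_p ⋐ Ŝ_q in (2) is stated only when ≺ is not the empty relation; this excludes just S = {0} with ≺ empty, where all axioms hold and Ŝ_0 = ∅ ⋐ ∅, but 0 ≺ 0 fails. *)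

(* Defs.v *)
(* MathComp / MathComp-Analysis *)
From HB Require Import structures.
From mathcomp Require Import all_boot all_order.
From mathcomp Require Import boolp classical_sets functions cardinality topology.

Set Implicit Arguments.
Unset Strict Implicit.
Unset Printing Implicit Defensive.

Import Order.TTheory.

Local Open Scope classical_set_scope.

Section Topology.
Context {X : topologicalType}.

(* [p ⋐ q]; meant for open [p] and [q]. *)
Definition compactly_below (p q : set X) : Prop :=
  forall C : set (set X), C `<=` open -> q `<=` \bigcup_(U in C) U ->
    exists F : set (set X),
      [/\ finite_set F, F `<=` C & p `<=` \bigcup_(U in F) U].

Definition irreducible_closed (C : set X) : Prop :=
  [/\ closed C, C !=set0 &
      ~ exists A B : set X,
          [/\ closed A, closed B, A `<` C, B `<` C & C = A `|` B]].

(* The finite family [F] may be empty, so that [set0] is in [S]. *)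
Definition is_cup_basis (S : set (set X)) : Prop :=
  basis S /\
  forall F : set (set X), finite_set F -> F `<=` S -> S (\bigcup_(U in F) U).

Lemma is_cup_basis0 (S : set (set X)) : is_cup_basis S -> S set0.
Proof. by case=> _ /(_ set0 (finite_set0 _) (@sub0set _ _)); rewrite bigcup_set0. Qed.

Lemma is_cup_basisU (S : set (set X)) (p q : set X) :
  is_cup_basis S -> S p -> S q -> S (p `|` q).
Proof.
move=> [_ SU] Sp Sq; have := SU [set p; q] (finite_set2 p q).
by rewrite bigcup_setU !bigcup_set1; apply=> r [->|->].
Qed.

End Topology.

Definition core_compact (X : topologicalType) : Prop :=
  forall (x : X) (O : set X), open O -> O x ->
    exists N : set X, [/\ open N, N x & compactly_below N O].

Definition sober (X : topologicalType) : Prop :=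
  forall C : set X, irreducible_closed C -> exists! x : X, C = closure [set x].

Definition homeomorphism (X Y : topologicalType) (f : X -> Y) : Prop :=
  exists g : Y -> X,
    [/\ cancel f g, cancel g f, continuous f & continuous g].

Section Order.
Context {d : Order.disp_t} {S : bJoinSemilatticeType d}.
Implicit Types (F I P : set S) (prec : S -> S -> Prop).

Definition order_filter F : Prop :=
  F !=set0 /\
  forall p q : S, (F p /\ F q) <-> (exists r, [/\ F r, (r <= p)%O & (r <= q)%O]).

Definition order_ideal I : Prop :=
  I !=set0 /\
  forall p q : S, (I p /\ I q) <-> (exists r, [/\ I r, (p <= r)%O & (q <= r)%O]).

Definition prime_filter P : Prop := order_filter P /\ order_ideal (~` P).

Definition round prec P : Prop := forall p, P p -> exists2 r, P r & prec r p.

Definition spectrum_set prec : set (set S) :=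
  [set P | [/\ P <> setT, round prec P & prime_filter P]].

Definition distributive prec : Prop :=
  forall p s t : S, prec p (s `|` t)%O ->
    forall p', prec p' p ->
      exists s' t', [/\ prec s' s, prec t' t,
                        (p' <= s' `|` t')%O & (s' `|` t' <= p)%O].

Definition auxiliary prec : Prop :=
  (forall p p' q' q : S,
      (p <= p')%O -> prec p' q' -> (q' <= q)%O -> prec p q) /\
  (forall p q : S, prec p q -> (p <= q)%O).

Definition interpolative prec : Prop :=
  forall p q : S, prec p q -> exists2 s, prec p s & prec s q.

Definition approximating prec : Prop :=
  forall p q : S,
    (p <= q)%O <-> [set r | prec r p] `<=` [set r | prec r q].

Definition join_preserving prec : Prop :=
  forall p p' q q' : S,
    prec p' p -> prec q' q -> prec (p' `|` q')%O (p `|` q)%O.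

Definition join_predomain prec : Prop :=
  [/\ auxiliary prec, approximating prec, interpolative prec &
      join_preserving prec].

Definition distributive_join_predomain prec : Prop :=
  join_predomain prec /\ distributive prec.

(* The axioms of a distributive join-predomain do not exclude the empty
   relation on the one-element semilattice, for which [\bot] is not below
   itself although its basic open set, the empty set, is compactly below
   itself.  By the next lemma this is the only case in which [prec] is empty. *)
Lemma approximating_nonempty prec (q : S) :
  approximating prec -> q != \bot%O -> exists r, prec r q.
Proof.
move=> /(_ q \bot%O) [_ qP] q0; apply: contrapT => nq.
by move/negP: q0; apply; rewrite -lex0; apply: qP => r rq; case: nq; exists r.
Qed.

End Order.

Section Spectrum.
Context {d : Order.disp_t} {S : bJoinSemilatticeType d}.
Variable prec : S -> S -> Prop.

Definition spectrum : Type := set_type (spectrum_set prec).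

HB.instance Definition _ := Choice.on spectrum.

Definition spectrum_open (p : S) : set spectrum := [set P | val P p].

HB.instance Definition _ :=
  isSubBaseTopological.Build spectrum (range spectrum_open) id.

End Spectrum.

Section CupBasis.
Context {X : topologicalType} {S : set (set X)}.

(* The members of a cup-basis, as a semilattice; the proof [hS] only serves
   to find the join and the minimum. *)
Definition cup_basis_type (hS : is_cup_basis S) : Type := set_type S.

Variable hS : is_cup_basis S.
Implicit Types p q r : cup_basis_type hS.

HB.instance Definition _ := SubChoice.on (cup_basis_type hS).

HB.instance Definition _ :=
  [SubChoice_isSubPOrder of cup_basis_type hS by <: with set_display].

Definition cup_basis_join p q : cup_basis_type hS :=
  SigSub (mem_set (is_cup_basisU hS (set_valP p) (set_valP q))).

Definition cup_basis_bot : cup_basis_type hS :=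
  SigSub (mem_set (is_cup_basis0 hS)).

Fact cup_basis_leUx p q r :
  (cup_basis_join p q <= r)%O = (p <= r)%O && (q <= r)%O.
Proof. by rewrite -!Order.le_val leUx. Qed.

HB.instance Definition _ :=
  Order.POrder_isJoinSemilattice.Build set_display (cup_basis_type hS)
    cup_basis_leUx.

Fact cup_basis_le0x p : (cup_basis_bot <= p)%O.
Proof. by rewrite -Order.le_val le0x. Qed.

HB.instance Definition _ :=
  Order.hasBottom.Build set_display (cup_basis_type hS) cup_basis_le0x.

Lemma cup_basis_leE p q : (p <= q)%O <-> val p `<=` val q.
Proof. by rewrite -Order.le_val subsetEset. Qed.

Lemma cup_basis_joinE p q : val (p `|` q)%O = val p `|` val q.
Proof. by []. Qed.

Lemma cup_basis_botE : val (\bot%O : cup_basis_type hS) = set0.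
Proof. by []. Qed.

Definition cup_basis_prec p q : Prop := compactly_below (val p) (val q).

Definition cup_basis_at (x : X) : set (cup_basis_type hS) :=
  [set s | val s x].

End CupBasis.

Arguments cup_basis_prec {X S} hS p q.
Arguments cup_basis_at {X S} hS x _.
Arguments spectrum_open {d S} prec p _.

(* Main.v *)
(* For (1): a finite cover taken from a family of open sets closed under finite
   unions reduces to a single member, so applying the compactly-below relation
   to well-chosen families of basic open sets yields interpolation and
   distributivity; a prime filter [P] is recovered as the neighbourhood filter
   of the generic point of the complement of the union of the basic sets
   outside [P].
   For (2): interpolating repeatedly below [p] gives, whenever [r] is way below
   [p], a round filter containing [p] and lying above [r]; an ideal maximal
   among those avoiding a round filter has a round prime complement.  Hence
   [r] not in an ideal [J] yields a point of the spectrum that contains [p] and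
   avoids [J].  For the principal ideal of [q] this is the order isomorphism,
   and for the ideal of those [s] whose basic open set is finitely covered by a
   given family it is compactness. *)
Require Import Defs.
From HB Require Import structures.
From mathcomp Require Import all_boot all_order finmap.
From mathcomp Require Import boolp classical_sets functions cardinality topology.

Set Implicit Arguments.
Unset Strict Implicit.
Unset Printing Implicit Defensive.

Import Order.TTheory.

Local Open Scope classical_set_scope.

Lemma finite_bigcup_closed (T : Type) (D : set (set T)) :
  D set0 -> (forall U V, D U -> D V -> D (U `|` V)) ->
  forall F, finite_set F -> F `<=` D -> D (\bigcup_(U in F) U).
Proof.
move=> D0 DU F /finite_seqP[s ->{F}] sD; rewrite bigcup_seq big_seq.
by apply: (big_ind D) => // U Us; apply: sD.
Qed.

(** * Compact containment, irreducible closed sets and generic points *)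

Section CompactlyBelow.
Context {X : topologicalType}.
Implicit Types (p q r s U : set X) (D : set (set X)).

(** The union of a finite subcover is itself a member of [D]. Both directions of the duality use
    compactness in this form. *)
Lemma compactly_below_directed p q D :
  compactly_below p q -> D `<=` open -> D set0 ->
  (forall U V, D U -> D V -> D (U `|` V)) -> q `<=` \bigcup_(U in D) U ->
  exists2 U, D U & p `<=` U.
Proof.
move=> pq Dop D0 DU qD; have [F [Ffin FD pF]] := pq D Dop qD.
by exists (\bigcup_(U in F) U) => //; apply: finite_bigcup_closed.
Qed.

Lemma compactly_below_sub p q : open q -> compactly_below p q -> p `<=` q.
Proof.
move=> qop /(_ [set q]) []; [by move=> _ ->|by rewrite bigcup_set1|].
by move=> F [_ Fq pF] x /pF[U /Fq ->].
Qed.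

Lemma compactly_belowW p r s q :
  p `<=` r -> compactly_below r s -> s `<=` q -> compactly_below p q.
Proof.
move=> pr rs sq C Cop qC; have [F [Ffin FC rF]] := rs C Cop (subset_trans sq qC).
by exists F; split=> //; apply: subset_trans rF.
Qed.

Lemma compactly_below0 q : compactly_below set0 q.
Proof. by move=> C _ _; exists set0; split=> //; apply: sub0set. Qed.

Lemma compactly_belowU p p' q q' : compactly_below p' p -> compactly_below q' q ->
  compactly_below (p' `|` q') (p `|` q).
Proof.
move=> p'p q'q C Cop; rewrite subUset => -[pC qC].
have [F [Ffin FC p'F]] := p'p C Cop pC; have [G [Gfin GC q'G]] := q'q C Cop qC.
exists (F `|` G); split; first by rewrite finite_setU.
  by rewrite subUset.
by rewrite bigcup_setU; apply: setUSS.
Qed.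

Lemma core_compact_basis (B : set (set X)) (x : X) (O : set X) :
  core_compact X -> basis B -> open O -> O x ->
  exists U, [/\ B U, U x & compactly_below U O].
Proof.
move=> ccX [Bop Bb] Oop Ox; have [N [Nop Nx NO]] := ccX x O Oop Ox.
have [U [BU Ux] UN] := Bb x N (open_nbhs_nbhs (conj Nop Nx)).
by exists U; split=> //; apply: compactly_belowW NO _.
Qed.

(** An open set is a neighbourhood of each of its points, so if it contains a point of the closure
    it meets the singleton of [x]. *)
Lemma closure1_openP (x : X) U : open U -> (U `&` closure [set x] !=set0) <-> U x.
Proof.
move=> Uop; split=> [[y [Uy yx]]|Ux]; last by exists x; split=> //; apply: subset_closure.
by have [z [-> //]] := yx U (open_nbhs_nbhs (conj Uop Uy)).
Qed.

Lemma irreducible_closure1 (x : X) : irreducible_closed (closure [set x]).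
Proof.
split; [exact: closed_closure|by exists x; apply: subset_closure|].
move=> [A [B [Acl Bcl AC BC E]]].
have : (A `|` B) x by rewrite -E; apply: subset_closure.
have sub (Z : set X) : closed Z -> Z x -> closure [set x] `<=` Z.
  by move=> Zcl Zx; rewrite closureE; apply: smallest_sub => // _ ->.
by case=> [/(sub _ Acl)|/(sub _ Bcl)]; [move: AC|move: BC] => -[].
Qed.

(** Otherwise [C] would be the union of the proper closed subsets [C \ U] and [C \ V]. *)
Lemma irreducible_meet (C U V : set X) : irreducible_closed C -> open U -> open V ->
  U `&` C !=set0 -> V `&` C !=set0 -> U `&` V `&` C !=set0.
Proof.
move=> [Ccl _ Cirr] Uop Vop [x [Ux Cx]] [y [Vy Cy]]; apply: contrapT => UVC.
apply: Cirr; exists (C `\` U), (C `\` V); split.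
- by apply: closedI => //; apply: open_closedC.
- by apply: closedI => //; apply: open_closedC.
- by split=> [|/(_ x Cx)[] //]; apply: subDsetl.
- by split=> [|/(_ y Cy)[] //]; apply: subDsetl.
- rewrite -setDIr; apply/esym/setDidPl; rewrite -subset0 => z [Cz UVz].
  by apply: UVC; exists z.
Qed.

(** The last hypothesis is irreducibility phrased with open sets, the form that a filter provides:
    for a decomposition of [C] into proper closed [A] and [B], it would give a point of [C] outside
    both. *)
Lemma sober_generic_point (C : set X) : sober X -> closed C -> C !=set0 ->
  (forall U V, open U -> open V -> U `&` C !=set0 -> V `&` C !=set0 ->
     U `&` V `&` C !=set0) ->
  exists x, forall U, open U -> U `&` C !=set0 <-> U x.
Proof.
move=> soX Ccl C0 CI; have [|x [Cx _]] := soX C; last first.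
  by exists x => U Uop; rewrite Cx closure1_openP.
split=> // -[A [B [Acl Bcl [AC nCA] [BC nCB] E]]].
have [x [Cx nAx]] : C `\` A !=set0.
  by apply: contrapT => CA; apply: nCA => x Cx; apply: contrapT => nA; apply: CA; exists x.
have [y [Cy nBy]] : C `\` B !=set0.
  by apply: contrapT => CB; apply: nCB => y Cy; apply: contrapT => nB; apply: CB; exists y.
have [||z [[nAz nBz]]] := CI (~` A) (~` B) (closed_openC Acl) (closed_openC Bcl).
- by exists x.
- by exists y.
by rewrite E => -[].
Qed.

End CompactlyBelow.

(** * Filters and ideals of a join-semilattice *)

Section PrimeFilters.
Context {d : Order.disp_t} {S : bJoinSemilatticeType d}.
Implicit Types (p q r : S) (F I : set S).

Lemma order_filter_up F p q : order_filter F -> (p <= q)%O -> F p -> F q.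
Proof. by move=> [_ FP] pq Fp; have [] := (FP p q).2 (ex_intro _ p (And3 Fp (lexx p) pq)). Qed.

Lemma order_filter_meet F p q : order_filter F -> F p -> F q ->
  exists r, [/\ F r, (r <= p)%O & (r <= q)%O].
Proof. by move=> [_ FP] Fp Fq; apply/FP. Qed.

Lemma order_idealP I :
  order_ideal I <-> [/\ I \bot%O, forall p q, (p <= q)%O -> I q -> I p &
    forall p q, I p -> I q -> I (p `|` q)%O].
Proof.
split=> [[[p0 Ip0] IP]|[I0 Idown Ijoin]].
  have Idown p q : (p <= q)%O -> I q -> I p.
    by move=> pq Iq; have [] := (IP p q).2 (ex_intro _ q (And3 Iq pq (lexx q))).
  split=> // [|p q Ip Iq]; first exact: Idown Ip0.
  have [r [Ir pr qr]] := (IP p q).1 (conj Ip Iq).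
  by apply: Idown Ir; rewrite leUx pr.
split=> [|p q]; first by exists \bot%O.
split=> [[Ip Iq]|[r [Ir pr qr]]]; last by split; apply: Idown Ir.
by exists (p `|` q)%O; split; [exact: Ijoin|exact: leUl|exact: leUr].
Qed.

Lemma order_filter_intro F : F !=set0 -> (forall p q, (p <= q)%O -> F p -> F q) ->
  (forall p q, F p -> F q -> exists r, [/\ F r, (r <= p)%O & (r <= q)%O]) ->
  order_filter F.
Proof.
move=> F0 Fup FI; split=> // p q; split=> [[]|[r [Fr rp rq]]]; first exact: FI.
by split; apply: Fup Fr.
Qed.

End PrimeFilters.

(** * The topology of the spectrum *)

Section SpectrumTopology.
Context {d : Order.disp_t} {S : bJoinSemilatticeType d}.
Variable prec : S -> S -> Prop.
Implicit Types (P Q : spectrum prec) (p q r : S).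

Lemma spectrum_filter P : order_filter (val P).
Proof. by have [_ _ []] := set_valP P. Qed.

Lemma spectrum_ideal P : order_ideal (~` val P).
Proof. by have [_ _ []] := set_valP P. Qed.

Lemma spectrum_round P p : val P p -> exists2 r, val P r & prec r p.
Proof. by have [_ + _] := set_valP P; apply. Qed.

Lemma spectrum_up P p q : (p <= q)%O -> val P p -> val P q.
Proof. exact: order_filter_up (spectrum_filter P). Qed.

Lemma spectrum_join P p q : val P (p `|` q)%O <-> val P p \/ val P q.
Proof.
split=> [Ppq|[Pp|Pq]]; last first.
- by apply: spectrum_up Pq; apply: leUr.
- by apply: spectrum_up Pp; apply: leUl.
apply: contrapT => /not_orP[nPp nPq].
by have /order_idealP[_ _ /(_ p q nPp nPq)] := spectrum_ideal P.
Qed.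

Lemma spectrum_bot P : ~ val P \bot%O.
Proof. by have /order_idealP[] := spectrum_ideal P. Qed.

Lemma spectrum_openU p q :
  spectrum_open prec (p `|` q)%O = spectrum_open prec p `|` spectrum_open prec q.
Proof. by apply/seteqP; split=> P /spectrum_join. Qed.

Lemma spectrum_open_bot : spectrum_open prec \bot%O = set0.
Proof. by apply/seteqP; split=> P // /spectrum_bot. Qed.

Lemma spectrum_open_le p q : (p <= q)%O ->
  spectrum_open prec p `<=` spectrum_open prec q.
Proof. by move=> pq P; apply: spectrum_up. Qed.

Lemma open_spectrum_open p : open (spectrum_open prec p).
Proof.
exists [set spectrum_open prec p]; last by rewrite bigcup_set1.
move=> _ ->; exists [fset spectrum_open prec p]%fset.
  by move=> U /fset1P ->; apply: mem_set; exists p.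
by rewrite set_fset1 bigcap_set1.
Qed.

(** The subbasic sets already form a basis: lower bounds inside the filter [P] handle binary
    intersections, and non-emptiness of [P] handles the empty one. *)
Lemma spectrum_open_sub (O : set (spectrum prec)) P : open O -> O P ->
  exists2 p, val P p & spectrum_open prec p `<=` O.
Proof.
case=> D sD <- [B DB BP]; have [A sA EB] := sD _ DB.
suff [p Pp pB] : exists2 p, val P p & spectrum_open prec p `<=` B.
  by exists p => //; apply: subset_trans (bigcup_sup DB).
have EA : B = \big[setI/setT]_(U <- enum_fset A) U by rewrite -EB -bigcap_seq.
move: BP; rewrite EA; elim: (enum_fset A) (sA : {subset enum_fset A <= _}).
  move=> _ _; have [[p Pp] _] := spectrum_filter P.
  by exists p; rewrite // big_nil.
move=> U s IH sU; rewrite big_cons => -[UP /IH[V Vs|p Pp pV]].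
  by apply: sU; rewrite inE Vs orbT.
have /set_mem[q _ qU] := sU U (mem_head _ _).
rewrite -qU in UP; have [r [Pr rq rp]] := order_filter_meet (spectrum_filter P) UP Pp.
exists r => //; rewrite subsetI -qU; split; first exact: spectrum_open_le.
exact: subset_trans (spectrum_open_le rp) pV.
Qed.

End SpectrumTopology.

(** * From a cup-basis of a core compact sober space to its spectrum *)

Section CupBasisDuality.
Context {X : topologicalType} {S : set (set X)} (hS : is_cup_basis S).
Hypotheses (ccX : core_compact X) (soX : sober X).
Implicit Types (p q r s t : cup_basis_type hS) (A : set (cup_basis_type hS)).

Lemma cup_basis_open p : open (val p).
Proof. by have [[Sop _] _] := hS; apply: Sop; apply: set_valP. Qed.
Local Hint Resolve cup_basis_open : core.

Lemma cup_basis_open_sub (x : X) (O : set X) : open O -> O x ->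
  exists2 p : cup_basis_type hS, val p x & val p `<=` O.
Proof.
have [[_ Sb] _] := hS; move=> Oop Ox.
have [U [SU Ux] UO] := Sb x O (open_nbhs_nbhs (conj Oop Ox)).
by exists (SigSub (mem_set SU) : cup_basis_type hS).
Qed.

Lemma cup_basis_prec_sub (x : X) (O : set X) : open O -> O x ->
  exists2 p : cup_basis_type hS, val p x & compactly_below (val p) O.
Proof.
have [Sb _] := hS; move=> Oop Ox; have [U [SU Ux UO]] := core_compact_basis ccX Sb Oop Ox.
by exists (SigSub (mem_set SU) : cup_basis_type hS).
Qed.

Lemma cup_basis_directed (p q : set X) A :
  compactly_below p q -> A \bot%O -> (forall r s, A r -> A s -> A (r `|` s)%O) ->
  q `<=` \bigcup_(r in A) val r -> exists2 r, A r & p `<=` val r.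
Proof.
move=> pq A0 AU qA.
have [|||||_ [r Ar <-] pr] := @compactly_below_directed _ p q [set val r | r in A].
- exact: pq.
- by move=> _ [r _ <-].
- by exists \bot%O.
- by move=> _ _ [r Ar <-] [s As <-]; exists (r `|` s)%O => //; apply: AU.
- by rewrite bigcup_image.
by exists r.
Qed.

Lemma cup_basis_prec_bot q : cup_basis_prec hS \bot%O q.
Proof. exact: compactly_below0. Qed.

Lemma cup_basis_auxiliary : auxiliary (cup_basis_prec hS).
Proof.
split=> [p p' q' q|p q pq]; last first.
  by apply/cup_basis_leE; apply: compactly_below_sub pq.
by move=> /cup_basis_leE pp' + /cup_basis_leE; apply: compactly_belowW.
Qed.

Lemma cup_basis_approximating : approximating (cup_basis_prec hS).
Proof.
move=> p q; split=> [pq r rp|pq].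
  by apply: cup_basis_auxiliary.1 rp pq.
apply/cup_basis_leE => x px.
have [r rx /pq rq] := cup_basis_prec_sub (cup_basis_open p) px.
exact: compactly_below_sub rq _ rx.
Qed.

Lemma cup_basis_join_preserving : join_preserving (cup_basis_prec hS).
Proof. by move=> p p' q q'; apply: compactly_belowU. Qed.

Lemma cup_basis_prec_join p p' q : cup_basis_prec hS p q -> cup_basis_prec hS p' q ->
  cup_basis_prec hS (p `|` p')%O q.
Proof. by move=> pq p'q; have := cup_basis_join_preserving pq p'q; rewrite joinxx. Qed.

(** The [r] lying compactly below some [s] that lies compactly below [q] are closed under joins, and
    core compactness applied twice shows that they cover [q]. *)
Lemma cup_basis_interpolative : interpolative (cup_basis_prec hS).
Proof.
move=> p q pq.
have [|||r [s rs sq] pr] := cup_basis_directed (A :=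
  [set r | exists2 s, cup_basis_prec hS r s & cup_basis_prec hS s q]) pq.
- by exists \bot%O; apply: cup_basis_prec_bot.
- move=> r r' [s rs sq] [s' r's' s'q]; exists (s `|` s')%O.
    exact: cup_basis_join_preserving.
  exact: cup_basis_prec_join.
- move=> x qx; have [s sx sq] := cup_basis_prec_sub (cup_basis_open q) qx.
  have [r rx rs] := cup_basis_prec_sub (cup_basis_open s) sx.
  by exists r => //; exists s.
exists s => //; exact: compactly_belowW pr rs _.
Qed.

(** The joins of some [s'] below [s] and [t'] below [t] that stay inside [p] are closed under joins
    and cover [p]; one of them then contains [p']. *)
Lemma cup_basis_distributive : distributive (cup_basis_prec hS).
Proof.
move=> p s t pst p' p'p.
have [|||_ [s' [t' [s's t't stp ->]]] p'st] := cup_basis_directed (A :=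
  [set r | exists s' t', [/\ cup_basis_prec hS s' s, cup_basis_prec hS t' t,
    (s' `|` t' <= p)%O & r = (s' `|` t')%O]]) p'p.
- exists \bot%O, \bot%O; split; [exact: cup_basis_prec_bot..| |]; last by rewrite joinxx.
  by rewrite joinxx le0x.
- move=> _ _ [s1 [t1 [s1s t1t st1 ->]]] [s2 [t2 [s2s t2t st2 ->]]].
  exists (s1 `|` s2)%O, (t1 `|` t2)%O; split; [exact: cup_basis_prec_join..| |].
    by rewrite joinACA leUx st1.
  by rewrite joinACA.
(* Each point of [p] lies in [s] or in [t], so a small basic neighbourhood serves as one summand and
   [\bot] as the other. *)
- move=> x px; have below u : val u x ->
      exists r, [/\ val r x, cup_basis_prec hS r u & (r <= p)%O].
    move=> ux; have [|//|r rx rup] := @cup_basis_prec_sub x (val p `&` val u).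
      exact: openI.
    exists r; split=> //; first exact: compactly_belowW rup (@subIsetr _ _ _).
    apply/cup_basis_leE; apply: (@subset_trans _ (val p `&` val u)) => //.
    by apply: compactly_below_sub rup; apply: openI.
  have [/below[r [rx rs rp]]|/below[r [rx rt rp]]] := compactly_below_sub (cup_basis_open _) pst px.
    by exists r => //; exists r, \bot%O; rewrite joinx0; split=> //; apply: cup_basis_prec_bot.
  by exists r => //; exists \bot%O, r; rewrite join0x; split=> //; apply: cup_basis_prec_bot.
by exists s', t'; split=> //; apply/cup_basis_leE.
Qed.

Lemma cup_basis_predomain : distributive_join_predomain (cup_basis_prec hS).
Proof.
split; last exact: cup_basis_distributive.
split; [exact: cup_basis_auxiliary|exact: cup_basis_approximating| |].
  exact: cup_basis_interpolative.
exact: cup_basis_join_preserving.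
Qed.

(** Roundness is core compactness at [x]; lower bounds come from the basis property. *)
Lemma cup_basis_at_spectrum (x : X) : spectrum_set (cup_basis_prec hS) (cup_basis_at hS x).
Proof.
split=> [E|p px|]; first by have : [set: cup_basis_type hS] \bot%O by []; rewrite -E.
  by have [r rx rp] := cup_basis_prec_sub (cup_basis_open p) px; exists r.
split.
  apply: order_filter_intro => [|p q /cup_basis_leE pq /pq //|p q px qx].
    by have [p px _] := cup_basis_open_sub openT (I : setT x); exists p.
  have [||r rx rpq] := @cup_basis_open_sub x (val p `&` val q); [exact: openI|by []|].
  by exists r; split=> //; apply/cup_basis_leE => y /rpq[].
apply/order_idealP; split=> [[]|p q /cup_basis_leE pq + /pq //|p q npx nqx].
by case=> [/npx|/nqx].
Qed.

Definition cup_basis_point (x : X) : spectrum (cup_basis_prec hS) :=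
  SigSub (mem_set (cup_basis_at_spectrum x)).

(** Points with the same basic neighbourhoods have the same closure, and sobriety makes the generic
    point of that closure unique. *)
Lemma cup_basis_point_inj : injective cup_basis_point.
Proof.
move=> x y xy; have at_xy p : val p x = val p y.
  by have : val (cup_basis_point x) p = val (cup_basis_point y) p by rewrite xy.
have sub (u v : X) : (forall p, val p u = val p v) -> closure [set u] `<=` closure [set v].
  move=> uv z zu U; rewrite nbhsE => -[V [Vop Vz] VU].
  have [p pz pV] := cup_basis_open_sub Vop Vz.
  have : (val p `&` closure [set u]) !=set0 by exists z.
  rewrite closure1_openP // uv => pv.
  by exists v; split=> //; apply/VU/pV.
have [z [_ zP]] := soX (irreducible_closure1 x).
rewrite -(zP x erefl); apply: zP; apply/seteqP.
by split; apply: sub => p; rewrite at_xy.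
Qed.

(* The point of a prime filter [P] is the generic point of the complement of
   the union of the basic open sets that are not in [P]. *)
Lemma cup_basis_point_surj (P : spectrum (cup_basis_prec hS)) :
  exists x, cup_basis_point x = P.
Proof.
pose C : set X := ~` \bigcup_(s in ~` val P) val s.
have Ccl : closed C by apply: open_closedC; apply: bigcup_open.
(* If a member [s] of [P] missed [C], it would be covered by basic sets outside [P]. These are
   closed under joins, so some [r] in [P] compactly below [s] would lie inside one of them, against
   upward closure. *)
have PC s : val P s <-> val s `&` C !=set0.
  split=> [Ps|[x [sx Cx]]]; last by apply: contrapT => nPs; apply: Cx; exists s.
  apply: contrapT => sC; have [r Pr rs] := spectrum_round Ps.
  have /order_idealP[P0 _ PU] := spectrum_ideal P.
  have [x sx|t nPt rt] := cup_basis_directed rs P0 PU.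
    by apply: contrapT => Cx; apply: sC; exists x.
  by apply: nPt; apply: spectrum_up Pr; apply/cup_basis_leE.
have CO (U : set X) : open U -> U `&` C !=set0 -> exists2 p : cup_basis_type hS, val P p & val p `<=` U.
  move=> Uop [x [Ux Cx]]; have [p px pU] := cup_basis_open_sub Uop Ux.
  by exists p => //; apply/PC; exists x.
have [|U V Uop Vop /(CO _ Uop)[p Pp pU] /(CO _ Vop)[q Pq qV]|x xC] := sober_generic_point soX Ccl.
- by have [[p /PC[x [_ Cx]]] _] := spectrum_filter P; exists x.
- have [r [Pr /cup_basis_leE rp /cup_basis_leE rq]] := order_filter_meet (spectrum_filter P) Pp Pq.
  have /PC[x [rx Cx]] := Pr.
  by exists x; split=> //; split; [apply/pU/rp|apply/qV/rq].
exists x; apply/val_inj/seteqP; split=> p /=.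
  by move=> px; apply/PC/xC.
by move=> /PC/xC; apply.
Qed.

(** The basic open set of [p] in the spectrum corresponds to [val p], so continuity of both maps is
    checked on basic neighbourhoods. *)
Lemma cup_basis_point_homeo : homeomorphism cup_basis_point.
Proof.
have [g gP] := choice cup_basis_point_surj.
exists g; split=> [x|//||]; first exact/cup_basis_point_inj.
  apply/continuousP => O Oop; rewrite openE => x /= Ox.
  have [p px pO] := spectrum_open_sub Oop Ox; rewrite /interior nbhsE.
  by exists (val p) => [|y py]; [split|apply: pO].
apply/continuousP => O Oop; rewrite openE => P /= OgP; rewrite /interior nbhsE.
have [p pgP pO] := cup_basis_open_sub Oop OgP.
exists (spectrum_open _ p) => [|Q Qp]; first split.
- exact: open_spectrum_open.
- by rewrite -[P]gP.
- by apply: pO; move: Qp; rewrite -{1}[Q]gP.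
Qed.

End CupBasisDuality.

(** * Maximal ideals avoiding a given set *)

Section IdealSeparation.
Context {d : Order.disp_t} {S : bJoinSemilatticeType d}.
Implicit Types (p q r : S) (F I J K : set S).

Lemma maximal_ideal_avoiding F J : order_ideal J -> F `&` J = set0 ->
  exists I, [/\ order_ideal I, J `<=` I, F `&` I = set0 &
    forall K, order_ideal K -> I `<=` K -> F `&` K = set0 -> K `<=` I].
Proof.
move=> Jid FJ; have /order_idealP[J0 Jdown Jjoin] := Jid.
(* Zorn's lemma is applied to the sets [A] to be added to [J], so that the union of the empty chain
   also qualifies. *)
have [|A [[Aid FA] Amax]] :=
    @Zorn_bigcup S [set A | order_ideal (J `|` A) /\ F `&` (J `|` A) = set0]; last first.
  exists (J `|` A); split=> // K Kid JAK FK; apply: contrapT => KJA.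
  have JK : J `|` K = K by apply/setUidPr => p Jp; apply: JAK; left.
  apply: (Amax K); last by rewrite /= JK.
  by split=> [p Ap|KA]; [apply: JAK; right|apply: KJA => p /KA; right].
move=> C CP Ctot; split; last first.
  rewrite -subset0 => p [Fp [Jp|[A CA Ap]]]; first by rewrite -FJ.
  by have [_ <-] := CP _ CA; split=> //; right.
apply/order_idealP; split=> [|p q pq [Jq|[A CA Aq]]|p q]; first by left.
- by left; apply: Jdown Jq.
- have [/order_idealP[_ Adown _] _] := CP _ CA.
  by have [Jp|Ap] := Adown p q pq (or_intror Aq); [left|right; exists A].
have up A : C A -> (J `|` A) p -> (J `|` A) q ->
    (J `|` \bigcup_(B in C) B) (p `|` q)%O.
  move=> CA Ap Aq; have [/order_idealP[_ _ Ajoin] _] := CP _ CA.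
  by have [Jpq|Apq] := Ajoin p q Ap Aq; [left|right; exists A].
move=> [Jp|[A CA Ap]] [Jq|[B CB Bq]].
- by left; apply: Jjoin.
- by apply: (up B CB); [left|right].
- by apply: (up A CA); [right|left].
- have [AB|BA] := Ctot A B CA CB.
    by apply: (up B CB); right; first exact: AB.
  by apply: (up A CA); right; last exact: BA.
Qed.

(** This is the ideal generated by [I] and [p]; it is compared with a maximal [I] in the separation
    argument. *)
Lemma order_ideal_adjoin I p : order_ideal I ->
  order_ideal [set r | exists2 i, I i & (r <= i `|` p)%O].
Proof.
move=> /order_idealP[I0 Idown Ijoin]; apply/order_idealP; split.
- by exists \bot%O => //; apply: le0x.
- by move=> q r qr [i Ii ri]; exists i => //; apply: le_trans ri.
- move=> q r [i Ii qi] [j Ij rj]; exists (i `|` j)%O; first exact: Ijoin.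
  by rewrite -[p]joinxx joinACA leU2.
Qed.

End IdealSeparation.

(** * From a distributive predomain to its spectrum *)

Section PredomainDuality.
Context {d : Order.disp_t} {S : bJoinSemilatticeType d}.
Variable prec : S -> S -> Prop.
Hypothesis predS : distributive_join_predomain prec.
Implicit Types (p q r : S) (F I J : set S) (P Q : spectrum prec).

Let prec_aux p p' q' q : (p <= p')%O -> prec p' q' -> (q' <= q)%O -> prec p q.
Proof. by have [[[+ _] _ _ _] _] := predS; apply. Qed.

Let prec_le p q : prec p q -> (p <= q)%O.
Proof. by have [[[_ +] _ _ _] _] := predS; apply. Qed.

Let prec_approx : approximating prec.
Proof. by have [[]] := predS. Qed.

Let prec_interp : interpolative prec.
Proof. by have [[]] := predS. Qed.

Let prec_joinU : join_preserving prec.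
Proof. by have [[]] := predS. Qed.

Let prec_distr : distributive prec.
Proof. by have [] := predS. Qed.

Let prec_join p q r : prec p r -> prec q r -> prec (p `|` q)%O r.
Proof. by move=> pr qr; have := prec_joinU pr qr; rewrite joinxx. Qed.

(* The ideals fixed by this operation are those with round complement. *)
Definition round_closure I : set S := [set p | forall r, prec r p -> I r].

(** Closure under joins is where distributivity enters: interpolating [r] below the join of [p] and
    [q] bounds [r] by a join of elements way below [p] and way below [q]. *)
Lemma round_closure_ideal I : order_ideal I -> order_ideal (round_closure I).
Proof.
move=> /order_idealP[I0 Idown Ijoin]; apply/order_idealP; split.
- by move=> r /prec_le r0; apply: Idown I0.
- by move=> p q pq qI r rp; apply: qI; apply: prec_aux pq.
- move=> p q pI qI r /prec_interp[s rs spq].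
  have [p' [q' [p'p q'q rpq _]]] := prec_distr spq rs.
  by apply: Idown rpq _; apply: Ijoin; [apply: pI|apply: qI].
Qed.

(* If [f <= i `|` a] and [f <= i `|` b], then applying distributivity twice
   approximates the elements way below [f] by joins of elements of [I] and of
   lower bounds of [a] and [b]. *)
Lemma round_closure_meet I a b f : order_ideal I -> round_closure I `<=` I ->
  (forall r, (r <= a)%O -> (r <= b)%O -> I r) ->
  (exists2 i, I i & (f <= i `|` a)%O) -> (exists2 i, I i & (f <= i `|` b)%O) -> I f.
Proof.
move=> /order_idealP[_ Idown Ijoin] Iround Iab [i Ii fia] [j Ij fjb].
apply: (Iround) => r /prec_interp[s rs sf].
have [u [v [ui va ruv uvs]]] := prec_distr (prec_aux (lexx s) sf fia) rs.
apply: (Idown) ruv _; apply: (Ijoin); first exact: Idown (prec_le ui) Ii.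
have vjb : prec v (j `|` b)%O.
  by apply: prec_aux sf fjb; apply: le_trans uvs; apply: leUr.
apply: (Iround) => w wv; have [x [y [xj yb wxy xyv]]] := prec_distr vjb wv.
apply: (Idown) wxy _; apply: (Ijoin); first exact: Idown (prec_le xj) Ij.
apply: Iab; last exact: prec_le.
apply: le_trans (prec_le va); apply: le_trans xyv; exact: leUr.
Qed.

Lemma spectrum_separation F J : order_filter F -> round prec F -> order_ideal J ->
  F `&` J = set0 -> exists P, F `<=` val P /\ val P `&` J = set0.
Proof.
move=> Ffil Frd Jid FJ; have [I [Iid JI FI Imax]] := maximal_ideal_avoiding Jid FJ.
have [[p0 Fp0] _] := Ffil; have /order_idealP[I0 Idown Ijoin] := Iid.
have FnI p : F p -> ~ I p by move=> Fp Ip; have : (F `&` I) p by []; rewrite FI.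
(* Since [F] is round, the round closure of [I] still avoids [F], so maximality applies to it. *)
have Iround : round_closure I `<=` I.
  apply: Imax; first exact: round_closure_ideal.
    by move=> p Ip r /prec_le rp; apply: Idown Ip.
  rewrite -subset0 => p [/Frd[r Fr rp] /(_ r rp)]; exact: FnI.
(* By maximality, the ideal generated by [I] and an [a] outside [I] meets [F]. *)
have adjoin a : ~ I a -> exists2 f, F f & exists2 i, I i & (f <= i `|` a)%O.
  move=> nIa; apply: contrapT => nf; apply: nIa.
  apply: (Imax _ (order_ideal_adjoin a Iid)).
  - by move=> p Ip; exists p => //; apply: leUl.
  - by rewrite -subset0 => f [Ff fI]; apply: nf; exists f.
  - by exists \bot%O => //; apply: leUr.
have Pspec : spectrum_set prec (~` I).
  split.
  - by move=> E; have : [set: S] \bot%O by []; rewrite -E; apply.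
  - move=> p nIp; apply: contrapT => np; apply: nIp; apply: Iround => r rp.
    by apply: contrapT => nIr; apply: np; exists r.
  split; last by rewrite setCK.
  apply: order_filter_intro => [|p q pq nIp Iq|p q nIp nIq].
  - by exists p0; apply: FnI.
  - by apply: nIp; apply: Idown Iq.
  - apply: contrapT => nr.
    have [f Ff [i Ii fi]] := adjoin p nIp; have [g Fg [j Ij gj]] := adjoin q nIq.
    have [h [Fh hf hg]] := order_filter_meet Ffil Ff Fg.
    apply: (FnI h Fh); apply: (round_closure_meet (a := p) (b := q) Iid Iround).
    + by move=> r rp rq; apply: contrapT => nIr; apply: nr; exists r.
    + by exists i => //; apply: le_trans fi.
    + by exists j => //; apply: le_trans gj.
exists (SigSub (mem_set Pspec)); split; first exact: FnI.
by rewrite -subset0 => p [nIp /JI].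
Qed.

(** Iterated interpolation gives a descending sequence from [p] that stays above [r]; the filter is
    its upward closure. *)
Lemma round_filter_between r p : prec r p ->
  exists F, [/\ order_filter F, round prec F, F p & forall f, F f -> (r <= f)%O].
Proof.
move=> rp.
(* Choice needs a total function; where [prec r q] fails, the value [q] is a mere default. *)
have [|g gP] := @choice _ _ (fun q s => prec r q -> prec r s /\ prec s q).
  move=> q.
  have [/prec_interp[s rs sq]|nrq] := pselect (prec r q); first by exists s.
  by exists q.
pose c n := iter n g p.
have cP n : prec r (c n) by elim: n => // n IH; have [] := gP _ IH.
have cS n : prec (c n.+1) (c n) by have [] := gP _ (cP n).
have cD m n : (c (n + m)%N <= c m)%O.
  by elim: n => // n; apply: le_trans; apply: prec_le; apply: cS.
exists [set s | exists n, (c n <= s)%O]; split.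
- apply: order_filter_intro => [|s t st [n ns]|s t [m ms] [n nt]].
  + by exists p, 0%N.
  + by exists n; apply: le_trans st.
  + exists (c (n + m)%N); split; first by exists (n + m)%N.
      exact: le_trans ms.
    by rewrite addnC; apply: le_trans nt.
- move=> s [n ns]; exists (c n.+1); first by exists n.+1.
  exact: prec_aux (lexx _) (cS n) ns.
- by exists 0%N.
- by move=> s [n ns]; apply: le_trans ns; apply: prec_le.
Qed.

Lemma spectrum_avoiding r p J : prec r p -> order_ideal J -> ~ J r ->
  exists P, val P p /\ val P `&` J = set0.
Proof.
move=> rp Jid nJr; have [F [Ffil Frd Fp Fr]] := round_filter_between rp.
have [|P [FP PJ]] := spectrum_separation Ffil Frd Jid.
  rewrite -subset0 => s [/Fr rs Js]; apply: nJr.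
  by move: Jid => /order_idealP[_ + _]; apply; first exact: rs.
by exists P; split=> //; apply: FP.
Qed.

Lemma spectrum_open_leP p q :
  (p <= q)%O <-> spectrum_open prec p `<=` spectrum_open prec q.
Proof.
split=> [|pq]; first exact: spectrum_open_le.
(* By approximation it suffices to treat [r] way below [p]. The interpolant [s] must be below [q],
   since otherwise a point containing [p] would avoid the principal ideal of [q]. *)
apply/prec_approx => r /= /prec_interp[s rs sp]; apply: prec_aux rs _ => //.
apply: contrapT => sq.
have [|P [Pp Pq]] := @spectrum_avoiding s p [set x | (x <= q)%O] sp _ sq.
  apply/order_idealP; split=> [|x y /=|x y /= xq yq]; first exact: le0x.
    exact: le_trans.
  by rewrite leUx xq.
have : (val P `&` [set x | (x <= q)%O]) q by split; [exact: pq|exact: lexx].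
by rewrite Pq.
Qed.

Lemma spectrum_open_compactly_below p q : prec p q ->
  compactly_below (spectrum_open prec p) (spectrum_open prec q).
Proof.
move=> pq C Cop qC; apply: contrapT => nF.
pose J := [set s | exists G : set (set (spectrum prec)),
  [/\ finite_set G, G `<=` C & spectrum_open prec s `<=` \bigcup_(U in G) U]].
(* If [p] is not in [J], some point [P] contains [q] and avoids [J]. Yet [P] lies in a member of
   [C], and a basic neighbourhood of [P] inside that member has its index in [J]. *)
have [||P [Pq PJ]] := @spectrum_avoiding p q J pq; last 2 first.
- exact: nF.
- have [U CU UP] := qC P Pq; have [s Ps sU] := spectrum_open_sub (Cop _ CU) UP.
  suff : (val P `&` J) s by rewrite PJ.
  split=> //; exists [set U]; split; [exact: finite_set1|by move=> _ ->|].
  by rewrite bigcup_set1.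
apply/order_idealP; split.
- exists set0; split; [exact: finite_set0|exact: sub0set|].
  by rewrite spectrum_open_bot.
- move=> s t /spectrum_open_leP st [G [Gfin GC tG]].
  by exists G; split=> //; apply: subset_trans tG.
- move=> s t [G [Gfin GC sG]] [H [Hfin HC tH]]; exists (G `|` H); split.
  + by rewrite finite_setU.
  + by rewrite subUset.
  + by rewrite spectrum_openU bigcup_setU; apply: setUSS.
Qed.

(** Interpolate [p], [s], [q] and read [q] as the join of [\bot] and [q]: distributivity yields an
    element way below [\bot]. *)
Lemma prec_bot : (exists p q, prec p q) -> forall q, prec \bot%O q.
Proof.
move=> [p [q pq]] r; have [s ps sq] := prec_interp pq.
have [u [_ [u0 _ _ _]]] : exists s' t', [/\ prec s' \bot%O, prec t' q,
    (p <= s' `|` t')%O & (s' `|` t' <= s)%O].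
  by apply: prec_distr ps; rewrite join0x.
by apply: prec_aux u0 _; apply: le0x.
Qed.

(** For the converse, roundness shows that the basic sets of the [r] way below [q] cover that of
    [q], and a single one contains that of [p]. Non-emptiness of [prec] puts [\bot] among these [r],
    which supplies the empty union. *)
Lemma spectrum_open_precP p q : (exists p q, prec p q) ->
  prec p q <-> compactly_below (spectrum_open prec p) (spectrum_open prec q).
Proof.
move=> /prec_bot bot_prec; split=> [|pq]; first exact: spectrum_open_compactly_below.
have [||||_ [r rq <-] pr] := compactly_below_directed
    (D := [set spectrum_open prec r | r in [set r | prec r q]]) pq.
- by move=> _ [r _ <-]; apply: open_spectrum_open.
- by exists \bot%O; [exact: bot_prec|exact: spectrum_open_bot].
- move=> _ _ [r rq <-] [s sq <-]; exists (r `|` s)%O; first exact: prec_join.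
  exact: spectrum_openU.
- move=> P /spectrum_round[r Pr rq]; exists (spectrum_open prec r) => //.
  by exists r.
by move/spectrum_open_leP: pr => pr; apply: prec_aux pr rq _.
Qed.

Lemma spectrum_core_compact : core_compact (spectrum prec).
Proof.
move=> P O Oop OP; have [p Pp pO] := spectrum_open_sub Oop OP.
have [r Pr rp] := spectrum_round Pp; exists (spectrum_open prec r); split=> //.
  exact: open_spectrum_open.
exact: compactly_belowW (spectrum_open_compactly_below rp) pO.
Qed.

(** The specialization order of the spectrum is inclusion of filters. *)
Lemma closure_spectrumP P Q : closure [set P] Q <-> val Q `<=` val P.
Proof.
split=> [QP q Qq|QP U].
  have [_ [-> //]] := QP _ (open_nbhs_nbhs (conj (open_spectrum_open prec q) Qq)).
rewrite nbhsE => -[V [Vop VQ] VU]; have [q Qq qV] := spectrum_open_sub Vop VQ.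
by exists P; split=> //; apply/VU/qV/QP.
Qed.

(** The generic point of [C] is the filter [G] of all [p] whose basic open set meets [C];
    irreducibility gives its lower bounds. *)
Lemma spectrum_sober : sober (spectrum prec).
Proof.
move=> C Cirr; have [Ccl [P0 CP0] _] := Cirr.
pose G : set S := [set p | spectrum_open prec p `&` C !=set0].
have Gspec : spectrum_set prec G.
  split.
  - move=> E; have : [set: S] \bot%O by [].
    by rewrite -E => -[P [/spectrum_bot]].
  - by move=> p [P [/spectrum_round[r Pr rp] CP]]; exists r => //; exists P.
  split.
    apply: order_filter_intro => [|p q pq [P [Pp CP]]|p q Gp Gq].
    + by have [[p P0p] _] := spectrum_filter P0; exists p, P0.
    + by exists P; split=> //; apply: spectrum_up Pp.
    + have [P [[Pp Pq] CP]] := irreducible_meet Cirr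
        (open_spectrum_open prec p) (open_spectrum_open prec q) Gp Gq.
      have [r [Pr rp rq]] := order_filter_meet (spectrum_filter P) Pp Pq.
      by exists r; split=> //; exists P.
  apply/order_idealP; split.
  + by move=> [P [/spectrum_bot]].
  + by move=> p q pq nGq [P [Pp CP]]; apply: nGq; exists P; split=> //; apply: spectrum_up Pp.
  + by move=> p q nGp nGq [P [/spectrum_join[Pp|Pq] CP]]; [apply: nGp|apply: nGq]; exists P.
pose PG : spectrum prec := SigSub (mem_set Gspec).
have CE : C = closure [set PG].
  apply/seteqP; split=> Q.
    by move=> CQ; apply/closure_spectrumP => q Qq; exists Q.
  (* When [Q] is contained in [G], every basic neighbourhood of [Q] meets [C], which is closed. *)
  move=> /closure_spectrumP QG; apply: Ccl => U.
  rewrite nbhsE => -[V [Vop VQ] VU]; have [q Qq qV] := spectrum_open_sub Vop VQ.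
  by have [P [Pq CP]] := QG q Qq; exists P; split=> //; apply/VU/qV.
exists PG; split=> // Q CQ; apply/val_inj/seteqP; split.
- by apply/closure_spectrumP; rewrite -CQ CE; apply/closure_spectrumP.
- by apply/closure_spectrumP; rewrite -CE CQ; apply/closure_spectrumP.
Qed.

Lemma spectrum_cup_basis : is_cup_basis (range (spectrum_open prec)).
Proof.
split; last first.
  apply: finite_bigcup_closed; first by exists \bot%O => //; apply: spectrum_open_bot.
  by move=> _ _ [p _ <-] [q _ <-]; exists (p `|` q)%O => //; apply: spectrum_openU.
split=> [_ [p _ <-]|P U]; first exact: open_spectrum_open.
rewrite nbhsE => -[V [Vop VP] VU]; have [p Pp pV] := spectrum_open_sub Vop VP.
by exists (spectrum_open prec p); [split=> //; exists p|apply: subset_trans VU].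
Qed.

Lemma spectrum_open_bij :
  set_bij [set: S] (range (spectrum_open prec)) (spectrum_open prec).
Proof.
split=> [p _|p q _ _ pq|//]; first by exists p.
by apply/eqP; rewrite eq_le; apply/andP; split; apply/spectrum_open_leP; rewrite pq.
Qed.

End PredomainDuality.

Theorem theorem2p14 :
  (forall (X : topologicalType) (S : set (set X)) (hS : is_cup_basis S),
     core_compact X -> sober X ->
     distributive_join_predomain (cup_basis_prec hS) /\
     exists f : X -> spectrum (cup_basis_prec hS),
       (forall x : X, val (f x) = cup_basis_at hS x) /\ homeomorphism f)
  /\
  (forall (d : Order.disp_t) (S : bJoinSemilatticeType d)
      (prec : S -> S -> Prop),
     distributive_join_predomain prec ->
     [/\ core_compact (spectrum prec),
         sober (spectrum prec),
         is_cup_basis (range (spectrum_open prec)),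
         set_bij [set: S] (range (spectrum_open prec)) (spectrum_open prec) &
         (forall p q : S,
            (p <= q)%O <-> spectrum_open prec p `<=` spectrum_open prec q) /\
         ((exists p q : S, prec p q) ->
          forall p q : S,
            prec p q <->
            compactly_below (spectrum_open prec p) (spectrum_open prec q))]).
Proof.
split=> [X S hS ccX soX|d S prec predS].
  split; first exact: cup_basis_predomain.
  exists (cup_basis_point hS ccX); split=> // ; exact: cup_basis_point_homeo.
split.
- exact: spectrum_core_compact.
- exact: spectrum_sober.
- exact: spectrum_cup_basis.
- exact: spectrum_open_bij.
- split; first exact: spectrum_open_leP.
  by move=> h p q; apply: spectrum_open_precP.
Qed.
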